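(* Let $0\le\ell\le n$ be integers with $n\ge1$, and for $x=(x_1,\dots,x_n)$ let $e_\ell(x)=\sum_{S\subseteq[n]:|S|=\ell}\prod_{i\in S}x_i$ be the elementary symmetric polynomial of degree $\ell$. 1. If $x\in\mathbb{C}^n$ with $\sum_{i=1}^nx_i=0$ and $\sum_{i=1}^n|x_i|^2=n$, then (with the convention $0^0:=1$) $$|e_\ell(x)|^2\le\frac{n^n}{\ell^\ell(n-\ell)^{n-\ell}}<3\sqrt{\ell+1}\cdot\binom{n}{\ell}.$$ 2. If in addition $x\in\mathbb{R}^n$, then $$|e_\ell(x)|\le\sqrt{10\binom{n}{\ell}}.$$
   Context: $[n]=\{1,\dots,n\}$; $e_0(x)=1$. *)

(* Defs.v *)
From HB Require Import structures.
From mathcomp Require Import all_boot all_order all_algebra.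

Set Implicit Arguments.
Unset Strict Implicit.
Unset Printing Implicit Defensive.

Import GRing.Theory.
Local Open Scope ring_scope.

Definition elemsym (K : comNzRingType) (n l : nat) (x : 'I_n -> K) : K :=
  \sum_(S : {set 'I_n} | #|S| == l) \prod_(i in S) x i.

(* Main.v *)
Require Import Defs.
From HB Require Import structures.
From mathcomp Require Import all_boot all_order all_algebra.
From mathcomp Require Import reals complex.
From mathcomp Require Import cyclic separable cyclotomic.
From mathcomp Require Import ring lra.

(* Write s^2 = l/n, r^2 = (n-l)/n, and B = n^n / (l^l (n-l)^(n-l)), so that
   (s^l r^(n-l))^2 B = 1.  Cauchy's estimate gives
     |e_l(x)| s^l r^(n-l) <= avg_t prod_i |r + s x_i t|,
   t ranging over the N-th roots of unity, N > n.  By AM-GM each product is at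
   most 1, whence |e_l(x)|^2 <= B; and with L = l (n-l) / n, the function
   D k = k (k^k / k!)^2 satisfies D (l+m) <= 8 D l D m, because
   D (k+1) / D k = (1 + 1/k)^(2k+1) decreases; hence B^2 <= 8 L C(n,l)^2.
   For real x the products are usually much smaller than 1.  Put u_i = s x_i,
   c = Re t and y_i = |r + u_i t|^2 - 1, so that sum_i y_i = 0.  If the indices
   with |u_i| > 3 carry half of sum_i u_i^2 = l, the product is at most
   1 / (1 + l/36) for all t.  Otherwise the AM-GM deficit is at least a constant
   times the sum of y_i^2 over |u_i| <= 3, and projecting on u bounds this from
   below by a quadratic polynomial in c with a double root c0: the product is
   at most 1 / (1 + a (c - c0)^2) with a = L / 25.  The average of this Cauchy
   kernel over t is computed by partial fractions and is at most
   (2 a)^(-1/4) for large N.  In both cases |e_l(x)|^4 <= 25/2 B^2 / L, which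
   is at most 100 C(n,l)^2. *)

Set Implicit Arguments.
Unset Strict Implicit.
Unset Printing Implicit Defensive.

Import Order.TTheory GRing.Theory Num.Theory.
Local Open Scope ring_scope.
Local Open Scope complex_scope.

(** * Elementary inequalities *)

Lemma bernoulli (R : realDomainType) (x : R) (n : nat) :
  0 <= x -> 1 + n%:R * x <= (1 + x) ^+ n.
Proof.
move=> x0; elim: n => [|n IH]; first by rewrite expr0 mul0r addr0.
have x1 : 0 <= 1 + x by rewrite addr_ge0.
rewrite [leRHS]exprS (le_trans _ (ler_wpM2l x1 IH)) // -natr1.
have : 0 <= n%:R * (x * x) by rewrite !mulr_ge0.
lra.
Qed.

(** Binomial expansion cut after the cubic term; the induction step leaves the nonnegative remainder
    [v (v - 1) (v - 2) u^4 / 6]. The cubic term matters: the margin in [expr_1DV_decreasing] is only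
    of order [K^-3]. *)
Lemma bernoulli3 (R : realFieldType) (u : R) (N : nat) : 0 <= u ->
  1 + N%:R * u + N%:R * (N%:R - 1) / 2 * u ^+ 2
    + N%:R * (N%:R - 1) * (N%:R - 2) / 6 * u ^+ 3 <= (1 + u) ^+ N.
Proof.
move=> u0; elim: N => [|N IH]; first by rewrite expr0; lra.
rewrite [leRHS]exprS -natr1.
have N2 : 0 <= N%:R * (N%:R - 1) * (N%:R - 2) :> R.
  case: N {IH} => [|[|N]]; rewrite ?mul0r // ?subrr ?mulr0 ?mul0r //.
  by have := ler0n R N; rewrite -addn2 natrD => N0; rewrite !mulr_ge0 //; lra.
have u1 : 0 <= 1 + u by lra.
apply: (le_trans _ (ler_wpM2l u1 IH)).
rewrite -subr_ge0.
set v := N%:R in N2 *.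
have -> : (1 + u) * (1 + v * u + v * (v - 1) / 2 * u ^+ 2 + v * (v - 1) * (v - 2) / 6 * u ^+ 3)
  - (1 + (v + 1) * u + (v + 1) * (v + 1 - 1) / 2 * u ^+ 2
     + (v + 1) * (v + 1 - 1) * (v + 1 - 2) / 6 * u ^+ 3) = v * (v - 1) * (v - 2) * (u ^+ 4 / 6) by field.
by rewrite mulr_ge0 // divr_ge0 ?exprn_ge0.
Qed.

(** The quotient of the two bases is [1 + 1 / (K (K + 2))], so it is enough that its power [2 K + 1]
    exceeds [(1 + 1 / (K + 1))^2]; the cubic expansion shows this. *)
Lemma expr_1DV_decreasing (R : realFieldType) (k : nat) : (0 < k)%N ->
  (1 + k.+1%:R^-1) ^+ k.*2.+3 <= (1 + k%:R^-1) ^+ k.*2.+1 :> R.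
Proof.
move=> k0; have K1 : 1 <= k%:R :> R by rewrite ler1n.
rewrite -natr1; set K := k%:R in K1 *.
have -> : 1 + K^-1 = (1 + (K * (K + 2))^-1) * (1 + (K + 1)^-1) by field; lra.
rewrite exprMn -addn2 exprD mulrC ler_wpM2r //.
  by apply: exprn_ge0; apply: addr_ge0; rewrite ?invr_ge0; lra.
have u0 : 0 <= (K * (K + 2))^-1 by rewrite invr_ge0 mulr_ge0; lra.
apply: (le_trans _ (bernoulli3 _ u0)).
have -> : k.*2.+1%:R = 2 * K + 1 :> R by rewrite -natr1 -muln2 natrM mulrC.
rewrite -subr_ge0.
set X := (X in 0 <= X).
have -> : X = (K ^+ 4 + 5 * K ^+ 3 + 18 * K ^+ 2 + 16 * K - 1)
   / (3 * K ^+ 2 * (K + 2) ^+ 3 * (K + 1) ^+ 2) by rewrite /X; field; lra.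
apply: divr_ge0.
  have := exprn_ge0 4 (le_trans ler01 K1); have := exprn_ge0 3 (le_trans ler01 K1).
  have := exprn_ge0 2 (le_trans ler01 K1); lra.
by rewrite !mulr_ge0 ?exprn_ge0 //; lra.
Qed.

(** Raising one index multiplies the left side by a later, hence smaller, value of [g] than the
    right side. The inequality thus spreads from (1, 1), first along one index, then along the
    other. *)
Lemma supermul_of_ratio_decreasing (R : realFieldType) (D g : nat -> R) (c : R) :
  (forall k, 0 <= D k.+1) ->
  (forall k, D k.+2 = g k.+1 * D k.+1) ->
  (forall k, g k.+2 <= g k.+1) -> 
  (forall k, 0 <= g k.+1) -> D 2 <= c * (D 1 * D 1) ->
  forall l m, D (l.+1 + m.+1)%N <= c * (D l.+1 * D m.+1).
Proof.
move=> D0 Dg gdec g0 D2.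
have gmono j k : g (j + k).+1 <= g k.+1.
  by elim: j => // j IH; rewrite addSn (le_trans (gdec _)).
have step l m : D (l.+1 + m.+1)%N <= c * (D l.+1 * D m.+1) ->
    D (l.+2 + m.+1)%N <= c * (D l.+2 * D m.+1).
  move=> H; rewrite (Dg l) !addSn addnS (Dg (l + m).+1).
  have -> : c * (g l.+1 * D l.+1 * D m.+1) = g l.+1 * (c * (D l.+1 * D m.+1)) by ring.
  apply: (le_trans _ (ler_wpM2l (g0 _) H)); rewrite addSn addnS ler_wpM2r //.
  by rewrite addnC -addSn gmono.
have stepl m : D (1 + m.+1)%N <= c * (D 1 * D m.+1).
  elim: m => // m IH; rewrite addnC (mulrC (D 1)); apply: step.
  by rewrite addnC (mulrC (D m.+1)).
by elim=> [|l IH] m; [exact: stepl | exact: step].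
Qed.

Lemma entropy_binomial_bound (R : realFieldType) (l m : nat) :
  (0 < l)%N -> (0 < m)%N ->
  ((l + m)%:R ^+ (l + m) / (l%:R ^+ l * m%:R ^+ m)) ^+ 2 * (l + m)%:R
    <= 8 * l%:R * m%:R * 'C(l + m, l)%:R ^+ 2 :> R.
Proof.
pose a k : R := k%:R ^+ k / k`!%:R.
pose D k : R := k%:R * a k ^+ 2.
pose g k : R := (1 + k%:R^-1) ^+ k.*2.+1.
have D0 k : 0 <= D k.+1 by rewrite mulr_ge0 // sqr_ge0.
have g0 k : 0 <= g k.+1 by rewrite exprn_ge0 // addr_ge0 // invr_ge0.
have Dg k : D k.+2 = g k.+1 * D k.+1.
  rewrite /D /g /a !(factS k.+1) natrM; set K := k.+1.
  have f0 : K`!%:R != 0 :> R by rewrite pnatr_eq0 -lt0n fact_gt0.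
  have k0 : K%:R != 0 :> R by rewrite pnatr_eq0.
  have k1 : K.+1%:R != 0 :> R by rewrite pnatr_eq0.
  have -> : 1 + K%:R^-1 = K.+1%:R / K%:R :> R by rewrite -natr1; field.
  rewrite expr_div_n -addnn !(exprS _ K) (exprS _ (K + K)) !exprD.
  rewrite !expr_div_n.
  have kK : K%:R ^+ K != 0 :> R by rewrite expf_neq0.
  move: (K%:R ^+ K : R) kK (K.+1%:R ^+ K : R) (K.+1%:R : R) k1 => u u0 v w w0.
  by field; rewrite f0 k0 u0 w0.
have gdec k : g k.+2 <= g k.+1 by exact: expr_1DV_decreasing.
(* The constant 8 comes from here: [D 1 = 1] and [D 2 = 2 * 2^2]. *)
have D2 : D 2 <= 8 * (D 1 * D 1) by rewrite /D /a !factS fact0 !muln1 le_eqVlt; apply/orP; left; apply/eqP; field.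
have H := supermul_of_ratio_decreasing D0 Dg gdec g0 D2.
case: l m => // l [// | m] _ _; move: (H l m); set p := l.+1; set q := m.+1.
have p0 : 0 < p%:R :> R by rewrite ltr0n.
have q0 : 0 < q%:R :> R by rewrite ltr0n.
have n0 : 0 < (p + q)%:R :> R by rewrite ltr0n.
have bfac : 'C(p + q, p)%:R = (p + q)`!%:R / (p`!%:R * q`!%:R) :> R.
  have ff : p`!%:R * q`!%:R != 0 :> R by rewrite -natrM pnatr_eq0 muln_eq0 negb_or -!lt0n !fact_gt0.
  apply: (mulIf ff); rewrite divfK // -!natrM; congr _%:R.
  by rewrite -{2}(addKn p q) bin_fact // leq_addr.
rewrite bfac /D /a.
have fp0 : 0 < p`!%:R :> R by rewrite ltr0n fact_gt0.
have fq0 : 0 < q`!%:R :> R by rewrite ltr0n fact_gt0.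
have fn0 : 0 < (p + q)`!%:R :> R by rewrite ltr0n fact_gt0.
have pp0 : 0 < p%:R ^+ p :> R by rewrite exprn_gt0.
have qq0 : 0 < q%:R ^+ q :> R by rewrite exprn_gt0.
move: (p%:R ^+ p) (q%:R ^+ q) ((p + q)%:R ^+ _) pp0 qq0 => P Q N P0 Q0.
move: (p`!%:R) (q`!%:R) ((p + q)`!%:R) fp0 fq0 fn0 => fp fq fn fp0 fq0 fn0 {}H.
have /(ler_wpM2l) := H; move=> /(_ (fn ^+ 2 / (P * Q) ^+ 2)) Hm.
have {}Hm := Hm (divr_ge0 (sqr_ge0 _) (sqr_ge0 _)).
apply: le_trans (le_trans _ Hm) _; rewrite le_eqVlt; apply/orP; left; apply/eqP; field.
  by rewrite !gt_eqF.
by rewrite !gt_eqF.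
Qed.

(** * Roots of unity and Cauchy's estimate *)

(** [X^N - 1] splits and is separable in characteristic 0, so it has [N] distinct roots, enough for
    a primitive one. *)
Lemma prim_root_exists (F : numClosedFieldType) (N : nat) :
  (0 < N)%N -> exists w : F, N.-primitive_root w.
Proof.
move=> N_gt0; pose p : {poly F} := 'X^N - 1.
have [r Dp] := closed_field_poly_normal p.
move: Dp; rewrite (monicP (monicXnsubC _ _)) // scale1r => Dp.
have rn1 : all N.-unity_root r by apply/allP=> z; rewrite unity_rootE -root_prod_XsubC -Dp rootE !hornerE subr_eq0.
have sz_r : (N < (size r).+1)%N by rewrite -(size_prod_XsubC r id) -Dp size_XnsubC.
have [|w] := hasP (has_prim_root N_gt0 rn1 _ sz_r); last by exists w.
by rewrite -separable_prod_XsubC -Dp separable_Xn_sub_1 // pnatr_eq0 -lt0n.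
Qed.

Lemma sum_prim_root_expr (F : fieldType) (N k : nat) (w : F) :
  N.-primitive_root w -> ~~ (N %| k)%N -> \sum_(j < N) w ^+ (j * k) = 0.
Proof.
move=> wP Nk; have wk1 : w ^+ k - 1 != 0 by rewrite subr_eq0 -(prim_order_dvd wP).
apply: (mulfI wk1); rewrite mulr0.
under eq_bigr => j _ do rewrite mulnC exprM.
by rewrite -subrX1 -exprM mulnC exprM (prim_expr_order wP) expr1n subrr.
Qed.

(** Discrete Fourier extraction of a coefficient; the exponent [N - l] plays the role of [-l]. *)
Lemma sum_horner_prim_root (F : fieldType) (N l : nat) (w : F) (p : {poly F}) :
  N.-primitive_root w -> (size p <= N)%N -> (l < N)%N ->
  \sum_(j < N) w ^+ (j * (N - l)) * p.[w ^+ j] = N%:R * p`_l.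
Proof.
move=> wP sp lN.
under eq_bigr => j _ do rewrite (horner_coef_wide _ sp) mulr_sumr.
rewrite exchange_big /= (bigD1 (Ordinal lN)) //= [X in _ + X]big1 => [|k kl].
  rewrite addr0; under eq_bigr => j _.
    rewrite mulrCA -exprM -exprD -mulnDr subnK ?(ltnW lN) // mulnC exprM.
    rewrite (prim_expr_order wP) expr1n mulr1.
    over.
  by rewrite sumr_const card_ord mulr_natl.
under eq_bigr => j _ do rewrite mulrCA -exprM -exprD -mulnDr.
rewrite -mulr_sumr sum_prim_root_expr ?mulr0 //.
apply: contra kl => Nk; rewrite -val_eqE /=.
rewrite -[X in (k == X :> nat)](modn_small lN) -[X in X == _](modn_small (ltn_ord k)).
by rewrite -(eqn_modDl (N - l)) subnK ?(ltnW lN) // modnn.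
Qed.

Lemma prod_elemsym (K : comNzRingType) (n : nat) (x : 'I_n -> K) (r s t : K) :
  \prod_i (r + s * x i * t) =
  \sum_(k < n.+1) elemsym k x * s ^+ k * r ^+ (n - k) * t ^+ k.
Proof.
under eq_bigr => i _ do rewrite addrC.
rewrite bigA_distr; under [RHS]eq_bigr => k _ do rewrite /elemsym !mulr_suml.
rewrite (exchange_big_dep xpredT) //=; apply: eq_bigr => S _.
have cS : (#|S| < n.+1)%N by rewrite ltnS -[X in (_ <= X)%N]card_ord max_card.
rewrite (big_pred1 (Ordinal cS)) => [|k /=]; last by rewrite -val_eqE /= eq_sym.
rewrite (bigID (mem S)) /=.
rewrite (eq_bigr (fun i => s * x i * t)) => [|i ->] //.
rewrite [X in _ * X](eq_bigr (fun i => r)) => [|i /negPf ->] //.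
rewrite !big_split /= !prodr_const.
suff -> : #|[predC S]| = (n - #|S|)%N by ring.
by apply/eqP; rewrite -(eqn_add2l #|S|) subnKC // (cardC (mem S)) card_ord.
Qed.

Lemma norm_prim_root (F : numClosedFieldType) (N : nat) (w : F) (k : nat) :
  N.-primitive_root w -> `|w ^+ k| = 1.
Proof.
move=> wP; have N0 := prim_order_gt0 wP.
suff w1 : `|w| = 1 by rewrite normrX w1 expr1n.
apply/eqP; rewrite -(@pexpr_eq1 _ `|w| N) // -normrX (prim_expr_order wP) ?normr1 //.
Qed.

(* Cauchy's estimate on a circle, with the circle discretized by the [N]-th
   roots of unity. *)
Lemma norm_elemsym_le_avg (F : numClosedFieldType) (n N l : nat) (w r s : F)
    (x : 'I_n -> F) :
  N.-primitive_root w -> (n < N)%N -> (l <= n)%N -> 0 <= r -> 0 <= s ->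
  N%:R * (`|elemsym l x| * s ^+ l * r ^+ (n - l))
    <= \sum_(j < N) \prod_i `|r + s * x i * w ^+ j|.
Proof.
move=> wP nN ln r0 s0.
pose p := \poly_(k < n.+1) (elemsym k x * s ^+ k * r ^+ (n - k)).
have pE t : p.[t] = \prod_i (r + s * x i * t).
  by rewrite horner_poly prod_elemsym.
have szp : (size p <= N)%N by apply: leq_trans (size_poly _ _) _.
have := sum_horner_prim_root wP szp (leq_ltn_trans ln nN).
rewrite coef_poly ltnS ln => /(congr1 Num.norm).
rewrite !normrM normr_nat (ger0_norm (exprn_ge0 _ s0)) (ger0_norm (exprn_ge0 _ r0)) => <-.
apply: le_trans (ler_norm_sum _ _ _) _; apply: ler_sum => j _.
by rewrite normrM (norm_prim_root _ wP) mul1r pE normr_prod.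
Qed.

(** * AM-GM and the bound for complex points *)

Lemma prod_norm_le1 (F : numClosedFieldType) (n : nat) (x : 'I_n -> F) (r s t : F) :
  \sum_i x i = 0 -> \sum_i `|x i| ^+ 2 = n%:R -> 0 <= r -> 0 <= s ->
  s ^+ 2 + r ^+ 2 = 1 -> `|t| = 1 ->
  \prod_i `|r + s * x i * t| <= 1.
Proof.
move=> sum_x sum_x2 r0 s0 sr t1.
rewrite -(@expr_le1 _ 2) ?prodr_ge0 // -prodrXl.
have [|agm _] := leif_AGM (A := 'I_n) (E := fun i => `|r + s * x i * t| ^+ 2).
  by move=> i _; rewrite exprn_ge0.
apply: le_trans agm _.
(* The cross terms are linear in [x i] or its conjugate and sum to 0, so the mean of the squares is
   [r^2 + s^2 = 1]. *)
suff -> : \sum_(i in 'I_n) `|r + s * x i * t| ^+ 2 = n%:R.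
  by rewrite card_ord; case: (n) => [|m]; rewrite ?expr0 // divff ?expr1n ?pnatr_eq0.
have rR : Num.conj r = r by exact: geC0_conj.
have sR : Num.conj s = s by exact: geC0_conj.
have E i : `|r + s * x i * t| ^+ 2 =
    r ^+ 2 + r * s * Num.conj t * Num.conj (x i) + r * s * t * x i + s ^+ 2 * `|x i| ^+ 2.
  rewrite normCK rmorphD !rmorphM /= rR sR.
  have -> : s ^+ 2 * `|x i| ^+ 2 = s ^+ 2 * `|x i| ^+ 2 * `|t| ^+ 2 by rewrite t1 expr1n mulr1.
  by rewrite (normCK t) (normCK (x i)); ring.
rewrite (eq_bigr _ (fun i _ => E i)) !big_split /= -!mulr_sumr -rmorph_sum sum_x sum_x2.
rewrite rmorph0 sumr_const card_ord -[r *+ n]mulr_natr.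
by transitivity ((s ^+ 2 + r ^+ 2) * n%:R); [ring | rewrite sr mul1r].
Qed.

Lemma elemsym_sqr_le (F : numClosedFieldType) (n l : nat) (x : 'I_n -> F) :
  (0 < n)%N -> (l <= n)%N -> \sum_i x i = 0 -> \sum_i `|x i| ^+ 2 = n%:R ->
  `|elemsym l x| ^+ 2 <= n%:R ^+ n / (l%:R ^+ l * (n - l)%:R ^+ (n - l)).
Proof.
move=> n0 ln sum_x sum_x2.
have n0F : 0 < n%:R :> F by rewrite ltr0n.
have n0' : n%:R != 0 :> F by rewrite gt_eqF.
pose s : F := sqrtC (l%:R / n%:R); pose r : F := sqrtC ((n - l)%:R / n%:R).
have s0 : 0 <= s by rewrite sqrtC_ge0 divr_ge0.
have r0 : 0 <= r by rewrite sqrtC_ge0 divr_ge0.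
have sr : s ^+ 2 + r ^+ 2 = 1.
  by rewrite !sqrtCK -mulrDl -natrD subnKC // divff.
have [w wP] := prim_root_exists F (ltn0Sn n).
have := norm_elemsym_le_avg x wP (ltnSn n) ln r0 s0.
have N0 : 0 < n.+1%:R :> F by rewrite ltr0n.
have H : \sum_(j < n.+1) \prod_i `|r + s * x i * w ^+ j| <= n.+1%:R * 1.
  rewrite mulr1 -[n.+1 in leRHS]card_ord -sumr_const; apply: ler_sum => j _.
  by apply: prod_norm_le1 => //; rewrite (norm_prim_root _ wP).
move=> /le_trans/(_ H); rewrite ler_pM2l //.
have e0 : 0 <= `|elemsym l x| * s ^+ l * r ^+ (n - l) by rewrite !mulr_ge0 ?exprn_ge0.
rewrite -(@expr_le1 _ 2) // !exprMn -!exprM !(mulnC _ 2) !exprM !sqrtCK.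
(* This also covers [l = 0] and [l = n], as [0^0 = 1]. *)
have W0 : 0 < l%:R ^+ l * (n - l)%:R ^+ (n - l) :> F.
  by rewrite -!natrX -natrM ltr0n muln_gt0 !expn_gt0 !lt0n !orNb.
rewrite ler_pdivlMr // => H1.
have -> : `|elemsym l x| ^+ 2 * (l%:R ^+ l * (n - l)%:R ^+ (n - l)) =
   (`|elemsym l x| ^+ 2 * (l%:R / n%:R) ^+ l * ((n - l)%:R / n%:R) ^+ (n - l)) * n%:R ^+ n.
  have nE : n%:R ^+ n = n%:R ^+ l * n%:R ^+ (n - l) :> F by rewrite -exprD subnKC.
  rewrite !expr_div_n nE; field.
  by rewrite !expf_neq0.
by rewrite -[leRHS]mul1r ler_wpM2r // exprn_ge0 // ltW.
Qed.

(** * The average of the Cauchy kernel over roots of unity *)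

(** The truncated geometric series [p] takes the value [(1 - z^N) / (1 - z w^j)] at [w^j]; averaging
    extracts its constant coefficient 1. *)
Lemma sum_inv_1Bprim_root (F : fieldType) (N : nat) (w z : F) :
  N.-primitive_root w -> z ^+ N != 1 ->
  \sum_(j < N) (1 - z * w ^+ j)^-1 = N%:R / (1 - z ^+ N).
Proof.
move=> wP zN; have N0 := prim_order_gt0 wP.
have zN' : 1 - z ^+ N != 0 by rewrite subr_eq0 eq_sym.
pose p := \poly_(k < N) z ^+ k.
have := sum_horner_prim_root wP (size_poly _ _ : size p <= N)%N N0.
rewrite coef_poly N0 expr0 mulr1 => <-; rewrite mulr_suml; apply: eq_bigr => j _.
rewrite subn0 mulnC exprM (prim_expr_order wP) expr1n mul1r horner_poly.
under eq_bigr => k _ do rewrite -exprMn.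
have zwN : (z * w ^+ j) ^+ N = z ^+ N.
  by rewrite exprMn -exprM mulnC exprM (prim_expr_order wP) expr1n mulr1.
have zw : 1 - z * w ^+ j != 0.
  rewrite subr_eq0 eq_sym; apply: contra zN => /eqP zw1.
  by rewrite -zwN zw1 expr1n.
apply: (mulfI zw); rewrite divff // mulrA -opprB mulNr -subrX1 zwN opprB.
by rewrite divff.
Qed.

(* Partial fractions: with [2 c = t + t^-1] and [2 w = z + z^-1],
   [2 z (w - c) = (1 - z t) (1 - z / t)]. *)
Lemma sum_resolvent_prim_root (F : numFieldType) (N : nat) (w z : F) :
  N.-primitive_root w -> z != 0 -> `|z| < 1 -> `|w| = 1 ->
  \sum_(j < N) ((z + z^-1) / 2 - (w ^+ j + w ^- j) / 2)^-1
    = N%:R * (2 * z / (1 - z ^+ 2) * ((1 + z ^+ N) / (1 - z ^+ N))).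
Proof.
move=> wP z0 z1 w1; have N0 := prim_order_gt0 wP.
have w0 : w != 0 by rewrite -normr_gt0 w1.
have neq1 k (t : F) : (0 < k)%N -> `|t| = 1 -> 1 - z ^+ k * t != 0.
  move=> k0 t1; rewrite subr_eq0; apply/negP => /eqP/(congr1 Num.norm).
  rewrite normrM t1 mulr1 normr1 normrX => E.
  by have := exprn_ilt1 k (normr_ge0 z) z1; rewrite -lt0n k0 -E ltxx.
have wV : N.-primitive_root w^-1.
  case/andP: (wP) => _ /forallP wP'; rewrite /primitive_root_of_unity N0.
  by apply/forallP => i; move: (wP' i); rewrite !unity_rootE exprVn invr_eq1.
have zN : z ^+ N != 1 by have := neq1 N 1 N0 (normr1 _); rewrite mulr1 subr_eq0 eq_sym.
have zN' : 1 - z ^+ N != 0 by rewrite subr_eq0 eq_sym.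
have z2 : 1 - z ^+ 2 != 0 by have := neq1 2%N 1 isT (normr1 _); rewrite mulr1.
(* The bracket is the Poisson kernel, the sum of [z^|k| t^k] over all integers [k]; the two
   geometric series count [k = 0] twice, hence the [- 1]. *)
rewrite (eq_bigr (fun j : 'I_N => 2 * z / (1 - z ^+ 2) *
   ((1 - z * w ^+ j)^-1 + (1 - z * w^-1 ^+ j)^-1 - 1))).
  rewrite -mulr_sumr sumrB big_split /= !sum_inv_1Bprim_root // sumr_const card_ord.
  by field; rewrite zN' z2.
move=> j _; rewrite -exprVn.
have n1 := neq1 1%N (w ^+ j) isT; rewrite expr1 normrX w1 expr1n in n1.
have n2 := neq1 1%N (w^-1 ^+ j) isT; rewrite expr1 normrX normfV w1 invr1 expr1n in n2.
have {}n1 := n1 erefl; have {}n2 := n2 erefl.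
have tV : w ^+ j * w^-1 ^+ j = 1 by rewrite -exprMn divff // expr1n.
have [t0 t0'] : w ^+ j != 0 /\ w^-1 ^+ j != 0 by rewrite !expf_neq0 ?invr_eq0.
move: (w ^+ j) (w^-1 ^+ j) n1 n2 tV t0 t0' => t u n1 n2 tV t0 _.
have Eu : u = t^-1 by apply: (mulfI t0); rewrite tV divff.
rewrite Eu in n2 *.
have n3 : t - z != 0.
  apply: contra n2; rewrite subr_eq0 => /eqP <-.
  by rewrite divff // subrr.
have -> : (z + z^-1) / 2 - (t + t^-1) / 2 = (1 - z * t) * (t - z) / (2 * z * t).
  by field; rewrite z0 t0.
by field; rewrite z0 t0 n1 n3 z2.
Qed.

Lemma expr_eventually_small (R : archiRealFieldType) (x e : R) (n : nat) :
  0 <= x < 1 -> 0 < e -> exists2 N, (n < N)%N & x ^+ N <= e.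
Proof.
move=> /andP[x0 x1] e0; have [->|xn0] := eqVneq x 0.
  by exists n.+1; rewrite ?expr0n //= ltW.
have {xn0} x0 : 0 < x by rewrite lt_neqAle eq_sym xn0.
pose h := x^-1 - 1; have h0 : 0 < h by rewrite subr_gt0 invf_gt1.
have eh0 : 0 <= (e * h)^-1 by rewrite invr_ge0 mulr_ge0 // ltW.
pose N := (n + Num.bound (e * h)^-1)%N.+1; exists N; first by rewrite ltnS leq_addr.
have N1 : (e * h)^-1 <= N%:R.
  by apply: le_trans (ltW (archi_boundP eh0)) _; rewrite ler_nat leqW // leq_addl.
rewrite -[x]invrK exprVn -[e]invrK lef_pV2 ?posrE ?exprn_gt0 ?invr_gt0 //.
have -> : x^-1 = 1 + h by rewrite /h; ring.
apply: le_trans (bernoulli N (ltW h0)).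
rewrite (le_trans (_ : _ <= N%:R * h)) ?lerDr //.
by rewrite -ler_pdivrMr // -invfM.
Qed.

(** The roots [W + q] and [W - q] of [z^2 - 2 W z + 1] have product 1. Either one lies inside the
    unit disc, or both are on the circle and conjugate, which makes [W] real. *)
Lemma joukowski_preimage (F : numClosedFieldType) (W : F) : W \isn't Num.real ->
  exists z, [/\ z != 0, `|z| < 1 & z + z^-1 = 2 * W].
Proof.
move=> WR; pose q := sqrtC (W ^+ 2 - 1).
have qq : (W + q) * (W - q) = 1 by rewrite mulrC -subr_sqr sqrtCK; ring.
have nz (u v : F) : u * v = 1 -> u != 0.
  by move=> uv; apply/eqP => u0; move: uv; rewrite u0 mul0r => /esym/eqP; rewrite oner_eq0.
have inv (u v : F) : u * v = 1 -> u^-1 = v.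
  by move=> uv; apply: (mulfI (nz _ _ uv)); rewrite uv divff // (nz _ _ uv).
have qq' : (W - q) * (W + q) = 1 by rewrite mulrC.
have [lt1|gt1|e1] := real_ltgtP (normr_real (W + q)) (real1 F).
- by exists (W + q); split; rewrite ?(nz _ _ qq) ?(inv _ _ qq) //; ring.
- exists (W - q); split; rewrite ?(nz _ _ qq') ?(inv _ _ qq') //; last ring.
  by rewrite -(inv _ _ qq) normfV invf_lt1 // (lt_trans ltr01).
- case/negP: WR; suff -> : W = 'Re (W + q) by apply: Creal_Re.
  rewrite ReE; have -> : Num.conj (W + q) = W - q.
    by rewrite -(inv _ _ qq) invC_norm e1 expr1n invr1 mul1r.
  by field.
Qed.

(** The kernel has its poles at [c +- i s] with [s = a^(-1/2)], so its sum is read off from the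
    resolvent sum at [W = c + i s]. Fourth powers remove the square root of [W^2 - 1]. *)
Lemma sum_cauchy_kernel_le (R : archiRcfType) (a c : R) (n : nat) : 0 < a ->
  exists2 N, (n < N)%N & forall w : R[i], N.-primitive_root w ->
    a * (\sum_(j < N) (1 + a * (complex.Re (w ^+ j) - c) ^+ 2)^-1) ^+ 4
      <= N%:R ^+ 4 / 2.
Proof.
move=> a0; pose s := (Num.sqrt a)^-1.
have s0 : 0 < s by rewrite invr_gt0 sqrtr_gt0.
have as2 : a = s ^- 2 by rewrite /s exprVn invrK sqr_sqrtr // ltW.
pose W : R[i] := c +i* s.
have WR : W \isn't Num.real by rewrite complex_real gt_eqF.
have [z [z0 z1 zW]] := joukowski_preimage WR.
have [x xE] : exists x, `|z| = x%:C by exists (ComplexField.Normc.normc z).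
have x01 : 0 <= x < 1 by rewrite -lecR -ltcR -xE normr_ge0.
(* With [|z^N| <= 1/21] the factor [(1 + z^N) / (1 - z^N)] has modulus at most 11/10, and
   [(11/10)^4 / 4 <= 1/2]. *)
have e0 : 0 < 21^-1 :> R by rewrite invr_gt0.
have [N nN xN] := expr_eventually_small n x01 e0.
exists N => // w wP.
have zN : `|z ^+ N| <= 21^-1.
  by rewrite normrX xE -rmorphXn /= (le_trans (_ : _ <= (21^-1)%:C)) ?lecR // fmorphV rmorph_nat.
have w1 : `|w| = 1 by have := norm_prim_root 1 wP; rewrite expr1.
have A := sum_resolvent_prim_root wP z0 z1 w1.
have zE : (z + z^-1) / 2 = W by rewrite zW; field.
rewrite zE in A.
set S := \sum_(j < N) _.
have ImD (u v : R[i]) : complex.Im (u + v) = complex.Im u + complex.Im v.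
  by case: u v => [? ?] [? ?].
(* The kernel is [- s Im ((W - Re t)^-1)], and [|W^2 - 1| >= 2 s]. *)
have SE : S = - s * complex.Im (\sum_(j < N) (W - (w ^+ j + w ^- j) / 2)^-1).
  rewrite (big_morph (@complex.Im R) ImD (erefl : complex.Im (0 : R[i]) = 0)) mulr_sumr.
  apply: eq_bigr => j _; have := norm_prim_root j wP; move: (w ^+ j) => t t1.
  rewrite (invc_norm t) t1 expr1n invr1 mul1r addcJ mulrAC divff ?pnatr_eq0 // mul1r.
  set r := complex.Re t.
  have -> : W - r%:C = (c - r) +i* s by rewrite /W; simpc.
  rewrite /= as2.
  have d0 : (c - r) ^+ 2 + s ^+ 2 != 0.
    by rewrite gt_eqF // ltr_wpDl ?sqr_ge0 // exprn_gt0.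
  field.
  by rewrite (gt_eqF s0) d0.
have S2 : (S ^+ 2)%:C <= (s ^+ 2)%:C * (`|\sum_(j < N) (W - (w ^+ j + w ^- j) / 2)^-1|) ^+ 2.
  rewrite SE -add_Re2_Im2 -rmorphM lecR exprMn sqrrN ler_wpM2l ?sqr_ge0 //.
  by rewrite lerDr sqr_ge0.
have z2 : 1 - z ^+ 2 != 0.
  rewrite subr_eq0; apply/eqP => E.
  by have := exprn_ilt1 2 (normr_ge0 z) z1; rewrite -normrX -E normr1 ltxx.
have B : `|2 * z / (1 - z ^+ 2)| ^+ 4 <= (s ^- 2 / 4)%:C.
  (* The right side is [|W^2 - 1|^2]; the difference of the two sides is exactly
     [(c^2 + s^2 - 1)^2]. *)
  have W0 : 4 * s ^+ 2 <= (c ^+ 2 - s ^+ 2 - 1) ^+ 2 + (2 * c * s) ^+ 2.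
    have : 0 <= (c ^+ 2 + s ^+ 2 - 1) ^+ 2 by exact: sqr_ge0.
    lra.
  have W1 : W ^+ 2 - 1 = (c ^+ 2 - s ^+ 2 - 1) +i* (2 * c * s).
    by apply/eqP; rewrite eq_complex /=; apply/andP; split; apply/eqP; ring.
  have -> : `|2 * z / (1 - z ^+ 2)| ^+ 4 = (`|W ^+ 2 - 1| ^+ 2)^-1.
    have -> : W ^+ 2 - 1 = ((1 - z ^+ 2) / (2 * z)) ^+ 2 by rewrite -zE; field.
    rewrite -[LHS]normrX -[`|((1 - z ^+ 2) / (2 * z)) ^+ 2| ^+ 2]normrX -normfV.
    by congr (`|_|); field; rewrite z0.
  rewrite -add_Re2_Im2 W1 /= -fmorphV lecR -[s ^- 2 / 4]invrK lef_pV2 ?posrE.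
  - by rewrite invf_div invrK (le_trans _ W0).
  - by rewrite (lt_le_trans _ W0) // mulr_gt0 // exprn_gt0.
  - by rewrite invr_gt0 divr_gt0 // invr_gt0 exprn_gt0.
have D : `|(1 + z ^+ N) / (1 - z ^+ N)| <= 11 / 10.
  have n1 : 20 / 21 <= `|1 - z ^+ N|.
    rewrite (le_trans _ (lerB_dist _ _)) // normr1 (_ : 20 / 21 = 1 - 21^-1) ?lerB //.
    by field.
  rewrite normf_div ler_pdivrMr; last by rewrite (lt_le_trans _ n1) // divr_gt0.
  rewrite (le_trans (ler_normD _ _)) // normr1 (@le_trans _ _ (11 / 10 * (20 / 21))) //.
    by rewrite (_ : 11 / 10 * (20 / 21) = 1 + 21^-1) ?lerD //; field.
  by rewrite ler_wpM2l ?divr_ge0.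
rewrite A normrM normr_nat [X in N%:R * X]normrM in S2.
pose p := ComplexField.Normc.normc (2 * z / (1 - z ^+ 2)).
pose d := ComplexField.Normc.normc ((1 + z ^+ N) / (1 - z ^+ N)).
have {}B : p ^+ 4 <= s ^- 2 / 4 by rewrite -lecR rmorphXn.
have {}D : d <= 11 / 10 by rewrite -lecR fmorph_div !rmorph_nat.
have {}S2 : S ^+ 2 <= s ^+ 2 * (N%:R * (p * d)) ^+ 2.
  rewrite -lecR (le_trans S2) // le_eqVlt; apply/orP; left; apply/eqP.
  by rewrite [RHS]rmorphM [X in _ = _ * X]rmorphXn !(rmorphM _ N%:R) !(rmorphM _ p) /= rmorph_nat.
have nc0 (q : R[i]) : 0 <= ComplexField.Normc.normc q by case: q => ? ?; exact: sqrtr_ge0.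
have d0 : 0 <= d by exact: nc0.
have p0 : 0 <= p by exact: nc0.
have S4 : S ^+ 4 <= s ^+ 4 * N%:R ^+ 4 * (p ^+ 4 * d ^+ 4).
  have -> : s ^+ 4 * N%:R ^+ 4 * (p ^+ 4 * d ^+ 4) = (s ^+ 2 * (N%:R * (p * d)) ^+ 2) ^+ 2 by ring.
  have -> : S ^+ 4 = (S ^+ 2) ^+ 2 by ring.
  by rewrite ler_pXn2r // nnegrE ?sqr_ge0 // mulr_ge0 ?sqr_ge0.
have D4 : d ^+ 4 <= (11 / 10) ^+ 4 by rewrite lerXn2r // nnegrE divr_ge0.
have s4 : 0 <= s ^+ 4 * N%:R ^+ 4 by rewrite mulr_ge0 ?exprn_ge0 // ltW.
have pd : p ^+ 4 * d ^+ 4 <= s ^- 2 / 4 * (11 / 10) ^+ 4 by rewrite ler_pM ?exprn_ge0.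
have := ler_wpM2l (ltW a0) (le_trans S4 (ler_wpM2l s4 pd)).
move=> /le_trans; apply.
have -> : a * (s ^+ 4 * N%:R ^+ 4 * (s ^- 2 / 4 * (11 / 10) ^+ 4)) = N%:R ^+ 4 * ((11 / 10) ^+ 4 / 4).
  by rewrite as2; field; rewrite gt_eqF.
by rewrite ler_wpM2l ?exprn_ge0 //; lra.
Qed.

(** * Products over real points *)

(** With [t = S / n], AM-GM bounds the product by [(1 - t)^n]. This is at most [(1 + t)^-n], and
    Bernoulli gives [1 + S <= (1 + t)^n]. *)
Lemma prod_le_inv_deficit (R : realFieldType) (n : nat) (b : 'I_n -> R) (S : R) :
  (forall i, 0 <= b i) -> 0 <= S -> \sum_i b i <= n%:R - S ->
  \prod_i b i <= (1 + S)^-1.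
Proof.
move=> b0 S0 bS.
have [|agm _] := leif_AGM (A := 'I_n) (E := b); first by move=> i _.
apply: le_trans agm _; rewrite card_ord.
have B0 : 0 <= \sum_(i in 'I_n) b i by apply: sumr_ge0.
have [n0 | n0] := posnP n.
  have -> : S = 0.
    apply/eqP; rewrite eq_le S0 andbT.
    by move: (le_trans B0 bS); rewrite n0 sub0r oppr_ge0.
  have E (q : R) : q ^+ n = 1 by rewrite n0 expr0.
  by rewrite E addr0 invr1.
have N0 : 0 < n%:R :> R by rewrite ltr0n.
pose t := S / n%:R.
have t0 : 0 <= t by rewrite divr_ge0.
have t1 : (\sum_(i in 'I_n) b i) / n%:R <= 1 - t.
  rewrite (_ : 1 - t = (n%:R - S) / n%:R) ?ler_pM2r ?invr_gt0 //.
  by rewrite /t mulrBl divff // gt_eqF.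
have t1' : 0 <= 1 - t by apply: le_trans t1; rewrite divr_ge0 // ltW.
have nS : 1 + S <= (1 + t) ^+ n.
  by apply: le_trans (bernoulli n t0); rewrite /t mulrC divfK // gt_eqF.
apply: (@le_trans _ _ ((1 - t) ^+ n)); first by rewrite lerXn2r // nnegrE divr_ge0 // ltW.
have S1 : 0 < 1 + S by rewrite ltr_pwDl.
rewrite -div1r ler_pdivlMr //.
apply: (@le_trans _ _ ((1 - t) ^+ n * (1 + t) ^+ n)); first by rewrite ler_wpM2l // exprn_ge0.
rewrite -exprMn exprn_ile1 //; last by have := sqr_ge0 t; lra.
by rewrite mulr_ge0 //; lra.
Qed.

(* [y u c + 1 = |r + u t|^2] for [|t| = 1] and [Re t = c]. *)
Lemma near_factor_damped (R : realFieldType) (r u c : R) :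
  0 <= r <= 1 -> -1 <= c <= 1 -> u ^+ 2 <= 9 ->
  let y := r ^+ 2 + 2 * r * u * c + u ^+ 2 - 1 in
  let b := 1 + (y - y ^+ 2 / 25) / 2 in 0 <= b /\ 1 + y <= b ^+ 2.
Proof.
move=> /andP[r0 r1] /andP[c0 c1] u9 y b.
have /andP[u1 u2] : -3 <= u <= 3.
  by rewrite -ler_norml -(ler_pXn2r (_ : 0 < 2)%N) ?nnegrE // real_normK ?num_real //; lra.
have uc : u * c <= 3.
  have : 0 <= (3 - u) * (1 + c) by rewrite mulr_ge0; lra.
  have : 0 <= (3 + u) * (1 - c) by rewrite mulr_ge0; lra.
  lra.
have ruc : r * (u * c) <= 3.
  have : 0 <= r * (3 - u * c) by rewrite mulr_ge0; lra.
  lra.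
have r2 : r ^+ 2 <= 1 by rewrite expr_le1.
have y15 : y <= 15 by rewrite /y; lra.
have y1 : 0 <= 1 + y.
  have : 0 <= u ^+ 2 * ((1 - c) * (1 + c)) by rewrite mulr_ge0 ?sqr_ge0 // mulr_ge0; lra.
  have := sqr_ge0 (r + u * c); rewrite /y; lra.
split.
  have : 0 <= (1 + y) * (15 - y) by rewrite mulr_ge0; lra.
  rewrite /b; lra.
(* This product is [2500 (b^2 - 1 - y)]: the damping constant 25 makes the upper bound 15 of [y] a
   root. *)
have : 0 <= y ^+ 2 * ((15 - y) * (35 - y)) by rewrite mulr_ge0 ?sqr_ge0 // mulr_ge0; lra.
rewrite /b; lra.
Qed.

(** Here [y >= |u|^2 - 2 |u| >= 3], and [b^2 - 1 - y = y (y - 3) / 9]. Against the undamped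
    [1 + y / 2] the factor [b] saves [y / 6], at least [u^2 / 18]. *)
Lemma far_factor_damped (R : realFieldType) (r u c : R) :
  0 <= r <= 1 -> -1 <= c <= 1 -> 9 <= u ^+ 2 ->
  let y := r ^+ 2 + 2 * r * u * c + u ^+ 2 - 1 in
  let b := 1 + y / 3 in [/\ 0 <= b, 1 + y <= b ^+ 2 & u ^+ 2 <= 3 * y].
Proof.
move=> /andP[r0 r1] /andP[c0 c1] u9 y b.
have v2 : `|u| ^+ 2 = u ^+ 2 by rewrite real_normK ?num_real.
have v3 : 3 <= `|u|.
  by rewrite -(ler_pXn2r (_ : 0 < 2)%N) ?nnegrE // v2; lra.
have uc : - `|u| <= u * c.
  have : `|u * c| <= `|u| by rewrite normrM ler_piMr // ler_norml c0 c1.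
  by rewrite ler_norml => /andP[].
have ruc : 0 <= r * (u * c + `|u|) by rewrite mulr_ge0; lra.
have H1 : 0 <= (1 - r) * (2 * `|u| - 1 - r) by rewrite mulr_ge0; lra.
have H2 : 0 <= `|u| * (`|u| - 3) by rewrite mulr_ge0; lra.
have y3 : u ^+ 2 <= 3 * y by rewrite /y; lra.
have H3 : 0 <= y * (y - 3) by rewrite mulr_ge0; lra.
by split=> //; rewrite /b; lra.
Qed.

Section RealProduct.
Variables (R : realFieldType) (n : nat) (u : 'I_n -> R) (r m : R).
Hypotheses (r01 : 0 <= r <= 1) (sum_u : \sum_i u i = 0).
Hypotheses (sum_u2 : \sum_i u i ^+ 2 = m) (mr : m + n%:R * r ^+ 2 = n%:R).

Let y c i := r ^+ 2 + 2 * r * u i * c + u i ^+ 2 - 1.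
Let near i := u i ^+ 2 <= 9.

(** Each [v i] is replaced by a damped majorant [b i]. As the [y c i] sum to 0, the majorants sum to
    [n] minus the total damping, which serves as the AM-GM deficit. *)
Lemma prod_le_damped (c : R) (v : 'I_n -> R) :
  -1 <= c <= 1 -> (forall i, 0 <= v i) ->
  (forall i, v i ^+ 2 = r ^+ 2 + 2 * r * u i * c + u i ^+ 2) ->
  \prod_i v i <=
    (1 + (\sum_(i | near i) y c i ^+ 2 / 50 + \sum_(i | ~~ near i) u i ^+ 2 / 18))^-1.
Proof.
move=> c1 v0 vE.
pose b i := if near i then 1 + (y c i - y c i ^+ 2 / 25) / 2 else 1 + y c i / 3.
have bP i : 0 <= b i /\ v i <= b i.
  have yE : v i ^+ 2 = 1 + y c i by rewrite vE /y; ring.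
  suff [b0 yb] : 0 <= b i /\ 1 + y c i <= b i ^+ 2.
    by split=> //; rewrite -(ler_pXn2r (_ : 0 < 2)%N) ?nnegrE // yE.
  rewrite /b; case: ifP => [ni | /negbT].
    exact: near_factor_damped.
  by rewrite -ltNge => /ltW ni; have [] := far_factor_damped r01 c1 ni.
have S0 : 0 <= \sum_(i | near i) y c i ^+ 2 / 50 + \sum_(i | ~~ near i) u i ^+ 2 / 18.
  by apply: addr_ge0; apply: sumr_ge0 => i _; rewrite divr_ge0 ?sqr_ge0.
apply: (le_trans (ler_prod _ _)) (prod_le_inv_deficit (b := b) _ S0 _).
- by move=> i _; rewrite v0; case: (bP i).
- by move=> i; case: (bP i).
have sy : \sum_i y c i = 0.
  rewrite /y sumrB !big_split /= sum_u2 !sumr_const card_ord -mulr_suml -mulr_sumr sum_u.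
  by rewrite -[r ^+ 2 *+ n]mulr_natl mulr0 mul0r addr0 [_ + m]addrC mr subrr.
have -> : n%:R = \sum_i (1 + y c i / 2) :> R.
  by rewrite big_split /= -mulr_suml sy mul0r addr0 sumr_const card_ord.
rewrite [X in X <= _](bigID near) [X in _ <= X - _](bigID near) /= opprD addrACA -!sumrB.
rewrite lerD //; apply: ler_sum => i ni; rewrite /b.
  by rewrite ni; lra.
rewrite (negPf ni); move: ni; rewrite -ltNge => /ltW ni.
by have [_ _ ] := far_factor_damped r01 c1 ni; rewrite -/(y c i); lra.
Qed.

(** [v i] stands for [|r + u i t|] with [|t| = 1] and [Re t = c], described without complex
    numbers. *)
Let factors (c : R) (v : 'I_n -> R) :=
  [/\ -1 <= c <= 1, forall i, 0 <= v i &
      forall i, v i ^+ 2 = r ^+ 2 + 2 * r * u i * c + u i ^+ 2].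

(** The split is on whether the near indices carry half of [m]. It depends on [u] alone, so one
    alternative, with one [c0], serves every [c]. *)
Lemma prod_le_kernel_or_cst : 0 < r -> 0 < m ->
  (exists c0, forall c v, factors c v ->
     \prod_i v i <= (1 + r ^+ 2 * m / 25 * (c - c0) ^+ 2)^-1)
  \/ (forall c v, factors c v -> \prod_i v i <= (1 + m / 36)^-1).
Proof.
move=> r0 m0.
have far0 : 0 <= \sum_(i | ~~ near i) u i ^+ 2 / 18.
  by apply: sumr_ge0 => i _; rewrite divr_ge0 ?sqr_ge0.
have near0 c : 0 <= \sum_(i | near i) y c i ^+ 2 / 50.
  by apply: sumr_ge0 => i _; rewrite divr_ge0 ?sqr_ge0.
pose U := \sum_(i | near i) u i ^+ 2.
have [mU | Um] := lerP (m / 2) U; last first.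
  right => c v [c1 v0 vE]; apply: le_trans (prod_le_damped c1 v0 vE) _.
  have := near0 c => nc.
  rewrite lef_pV2 ?posrE; try by lra.
  suff : m / 36 <= \sum_(i | ~~ near i) u i ^+ 2 / 18 by lra.
  by move: sum_u2; rewrite (bigID near) /= -/U -mulr_suml; lra.
left; pose V := \sum_(i | near i) u i * (r ^+ 2 + u i ^+ 2 - 1).
(* [y c i] is affine in [c], so its inner product with [u] over the near indices is [2 r U c + V];
   [c0] is the zero of this function. *)
have U0 : 0 < U by lra.
exists (- V / (2 * r * U)) => c v [c1 v0 vE].
apply: le_trans (prod_le_damped c1 v0 vE) _.
set d := c - _.
have d2 : 0 <= r ^+ 2 * m / 25 * d ^+ 2.
  by rewrite mulr_ge0 ?sqr_ge0 // divr_ge0 // mulr_ge0 ?sqr_ge0 // ltW.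
have nc := near0 c.
rewrite lef_pV2 ?posrE; try by lra.
rewrite lerD2l; apply: le_trans (_ : _ <= \sum_(i | near i) y c i ^+ 2 / 50) _; last by lra.
(* Projecting the vector [y] on the vector [u] leaves [2 r d u]. *)
pose t := 2 * r * d.
have proj : \sum_(i | near i) u i * y c i = t * U.
  have -> : t * U = 2 * r * c * U + V by rewrite /t /d; field; rewrite !gt_eqF.
  by rewrite /U /V mulr_sumr -big_split /=; apply: eq_bigr => i _; rewrite /y; ring.
have ge : 2 * t * (t * U) - t ^+ 2 * U <= \sum_(i | near i) y c i ^+ 2.
  rewrite -proj /U !mulr_sumr -sumrB; apply: ler_sum => i _.
  by have := sqr_ge0 (y c i - t * u i); lra.
rewrite -mulr_suml ler_pdivlMr //; apply: le_trans ge.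
have -> : 2 * t * (t * U) - t ^+ 2 * U = 4 * r ^+ 2 * d ^+ 2 * U by rewrite /t; ring.
have : 0 <= r ^+ 2 * d ^+ 2 * (U - m / 2).
  by rewrite mulr_ge0 ?subr_ge0 // mulr_ge0 ?sqr_ge0.
by lra.
Qed.

End RealProduct.

(** * The real case *)

Lemma normc_realC (R : rcfType) (x : R) : `|x%:C| = `|x|%:C.
Proof. by rewrite normc_def /= expr0n addr0 sqrtr_sqr. Qed.

Lemma elemsym_realC (R : rcfType) (n l : nat) (x : 'I_n -> R) :
  elemsym l (fun i => (x i)%:C) = (elemsym l x)%:C.
Proof.
rewrite /elemsym rmorph_sum; apply: eq_bigr => S _.
by rewrite rmorph_prod.
Qed.

(** For real [x i] the modulus [|r + s x_i t|] depends on [Re t] alone, so Cauchy's estimate can be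
    carried back to [R] with any majorant [h] of [Re t]. *)
Lemma norm_elemsym_real_le_avg (R : rcfType) (n N l : nat) (w : R[i]) (r s : R)
    (x : 'I_n -> R) (h : R -> R) :
  N.-primitive_root w -> (n < N)%N -> (l <= n)%N -> 0 <= r -> 0 <= s ->
  (forall c (v : 'I_n -> R), [/\ -1 <= c <= 1, forall i, 0 <= v i &
      forall i, v i ^+ 2 = r ^+ 2 + 2 * r * (s * x i) * c + (s * x i) ^+ 2] ->
    \prod_i v i <= h c) ->
  N%:R * (`|elemsym l x| * s ^+ l * r ^+ (n - l))
    <= \sum_(j < N) h (complex.Re (w ^+ j)).
Proof.
move=> wP nN ln r0 s0 hP.
have := norm_elemsym_le_avg (fun i => (x i)%:C) wP nN ln
  (_ : 0 <= r%:C) (_ : 0 <= s%:C); rewrite !ler0c => /(_ r0 s0).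
rewrite elemsym_realC normc_realC -!rmorphXn -(rmorph_nat (real_complex R)) -!rmorphM => H.
rewrite -lecR (le_trans H) // rmorph_sum ler_sum // => j _.
have := norm_prim_root j wP; move: (w ^+ j) => t t1.
have t2 : complex.Re t ^+ 2 + complex.Im t ^+ 2 = 1.
  by apply: complexI; rewrite add_Re2_Im2 t1 expr1n.
pose v i := ComplexField.Normc.normc (r%:C + s%:C * (x i)%:C * t).
have -> : \prod_i `|r%:C + s%:C * (x i)%:C * t| = (\prod_i v i)%:C by rewrite rmorph_prod.
rewrite lecR; apply: hP; split.
- rewrite -ler_norml -(ler_pXn2r (_ : 0 < 2)%N) ?nnegrE // real_normK ?num_real // expr1n -t2.
  by rewrite lerDl sqr_ge0.
- by move=> i; rewrite /v; case: (_ + _) => ? ?; exact: sqrtr_ge0.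
- move=> i; apply: complexI; rewrite rmorphXn /=.
  rewrite -[(v i)%:C]/(`|r%:C + s%:C * (x i)%:C * t|) -add_Re2_Im2; congr (_ %:C).
  case: t t1 t2 {v} => p q /= _ t2.
  transitivity (r ^+ 2 + 2 * r * (s * x i) * p + (s * x i) ^+ 2 * (p ^+ 2 + q ^+ 2)); first by ring.
  by rewrite t2 mulr1.
Qed.

Lemma elemsym_real_pow4_le (R : archiRcfType) (n l : nat) (r s : R) (x : 'I_n -> R) :
  (0 < l)%N -> (l <= n)%N -> \sum_i x i = 0 -> \sum_i x i ^+ 2 = n%:R ->
  0 < r -> 0 <= s -> n%:R * s ^+ 2 = l%:R -> s ^+ 2 + r ^+ 2 = 1 ->
  r ^+ 2 * l%:R / 25 * (`|elemsym l x| * s ^+ l * r ^+ (n - l)) ^+ 4 <= 1 / 2.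
Proof.
move=> l0 ln sum_x sum_x2 r0 s0 sE sr.
have r2 : r ^+ 2 <= 1 by have := sqr_ge0 s; lra.
have r01 : 0 <= r <= 1 by rewrite (ltW r0) -(@expr_le1 _ 2) // ltW.
have l0R : 0 < l%:R :> R by rewrite ltr0n.
have sum_u : \sum_i s * x i = 0 by rewrite -mulr_sumr sum_x mulr0.
have sum_u2 : \sum_i (s * x i) ^+ 2 = l%:R.
  by under eq_bigr do rewrite exprMn; rewrite -mulr_sumr sum_x2 mulrC.
have lr : l%:R + n%:R * r ^+ 2 = n%:R by rewrite -sE -mulrDr sr mulr1.
set Y := _ * r ^+ (n - l).
have Y0 : 0 <= Y by rewrite !mulr_ge0 ?exprn_ge0 // ltW.
set a := r ^+ 2 * _ / _.
have a0 : 0 < a by rewrite divr_gt0 // mulr_gt0 // exprn_gt0.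
have [[c0 hP]|hP] := prod_le_kernel_or_cst r01 sum_u sum_u2 lr r0 l0R.
  have [N nN HN] := sum_cauchy_kernel_le c0 n a0.
  have [w wP] := prim_root_exists R[i] (leq_ltn_trans (leq0n n) nN).
  have H := norm_elemsym_real_le_avg wP nN ln (ltW r0) s0 hP.
  have N0 : 0 < N%:R :> R by rewrite ltr0n (leq_ltn_trans _ nN).
  rewrite -(ler_pM2l (exprn_gt0 4 N0)) mulrCA -exprMn [leRHS]mulrA mulr1.
  apply: le_trans (HN w wP); rewrite ler_wpM2l ?(ltW a0) // lerXn2r // nnegrE.
    by rewrite mulr_ge0 // ltW.
  by rewrite (le_trans _ H) // mulr_ge0 // ltW.
have [w wP] := prim_root_exists R[i] (ltn0Sn n).
have H := norm_elemsym_real_le_avg wP (ltnSn n) ln (ltW r0) s0 hP.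
have {}H : Y <= (1 + l%:R / 36)^-1.
  by move: H; rewrite sumr_const card_ord -[leRHS]mulr_natl ler_pM2l // ltr0n.
have L0 : 0 < 1 + l%:R / 36 :> R by lra.
(* In the constant case Bernoulli with exponent 4 turns 1/36 into 1/9, and [(l / 25) / (1 + l / 9)]
   stays below 9/25. *)
have Y4 : Y ^+ 4 <= (1 + l%:R / 9)^-1.
  apply: (@le_trans _ _ ((1 + l%:R / 36)^-1 ^+ 4)).
    by rewrite lerXn2r // nnegrE invr_ge0 ltW.
  rewrite exprVn lef_pV2 ?posrE ?exprn_gt0 //; last lra.
  apply: le_trans (bernoulli 4 _); lra.
have al : a <= l%:R / 25.
  by rewrite ler_pM2r ?invr_gt0 // -[leRHS]mul1r ler_wpM2r // ltW.
apply: (@le_trans _ _ (l%:R / 25 * (1 + l%:R / 9)^-1)).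
  by rewrite ler_pM ?exprn_ge0 // ltW.
by rewrite ler_pdivrMr; lra.
Qed.

Lemma elemsym_real_le (R : archiRcfType) (n l : nat) (x : 'I_n -> R) :
  (0 < l)%N -> (l < n)%N -> \sum_i x i = 0 -> \sum_i x i ^+ 2 = n%:R ->
  `|elemsym l x| <= Num.sqrt (10 * 'C(n, l)%:R).
Proof.
move=> l0 ln sum_x sum_x2.
have nE : (l + (n - l))%N = n by rewrite subnKC // ltnW.
have m0 : (0 < n - l)%N by rewrite subn_gt0.
set m := (n - l)%N in nE m0 *.
have l0R : 0 < l%:R :> R by rewrite ltr0n.
have m0R : 0 < m%:R :> R by rewrite ltr0n.
have n0R : 0 < n%:R :> R by rewrite -nE natrD addr_gt0.
pose s : R := Num.sqrt (l%:R / n%:R); pose r : R := Num.sqrt (m%:R / n%:R).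
have s2 : s ^+ 2 = l%:R / n%:R by rewrite sqr_sqrtr // divr_ge0 // ltW.
have r2 : r ^+ 2 = m%:R / n%:R by rewrite sqr_sqrtr // divr_ge0 // ltW.
have n0' : n%:R != 0 :> R by rewrite gt_eqF.
have sr : s ^+ 2 + r ^+ 2 = 1 by rewrite s2 r2 -mulrDl -natrD nE divff.
have ns : n%:R * s ^+ 2 = l%:R by rewrite s2 mulrC divfK.
have r0 : 0 < r by rewrite sqrtr_gt0 divr_gt0.
have := elemsym_real_pow4_le l0 (ltnW ln) sum_x sum_x2 r0 (sqrtr_ge0 _) ns sr.
set X := `|_|; rewrite -/m => H.
have := @entropy_binomial_bound R l m l0 m0; rewrite nE.
set C : R := 'C(n, l)%:R; set B := _ / (_ * _) => HB.
have B0 : 0 < B by rewrite divr_gt0 // ?mulr_gt0 // exprn_gt0.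
have PB : (s ^+ l * r ^+ m) ^+ 2 * B = 1.
  rewrite exprMn -!exprM !(mulnC _ 2) !exprM s2 r2 !expr_div_n /B.
  have -> : n%:R ^+ n = n%:R ^+ l * n%:R ^+ m :> R by rewrite -exprD nE.
  by field; rewrite !expf_neq0 ?gt_eqF.
have X4 : X ^+ 4 * (r ^+ 2 * l%:R / 25) <= B ^+ 2 / 2.
  have -> : X ^+ 4 * (r ^+ 2 * l%:R / 25) =
      r ^+ 2 * l%:R / 25 * (X * s ^+ l * r ^+ m) ^+ 4 * B ^+ 2.
    transitivity (X ^+ 4 * (r ^+ 2 * l%:R / 25) * ((s ^+ l * r ^+ m) ^+ 2 * B) ^+ 2).
      by rewrite PB expr1n mulr1.
    by ring.
  by apply: le_trans (ler_wpM2r (sqr_ge0 B) H) _; lra.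
have C0 : 0 <= C by exact: ler0n.
have X2 : X ^+ 2 <= 10 * C.
  rewrite -(ler_pXn2r (_ : 0 < 2)%N) ?nnegrE ?sqr_ge0 ?mulr_ge0 // -[_ ^+ 2 ^+ 2]exprM.
  (* The target is [X^4 l m <= (25/2) n B^2 <= 100 l m C^2], by [X4] and then [HB]. *)
  have k0 : 0 < l%:R * m%:R :> R by rewrite mulr_gt0.
  rewrite -(ler_pM2r k0); rewrite r2 in X4.
  have : X ^+ 4 * (m%:R / n%:R * l%:R / 25) * (25 * n%:R) = X ^+ 4 * (l%:R * m%:R) by field.
  have nn : 0 <= 25 * n%:R :> R by rewrite mulr_ge0 // ltW.
  have := ler_wpM2r nn X4; rewrite -[(2 * 2)%N]/4%N.
  lra.
have -> : X = Num.sqrt (X ^+ 2) by rewrite sqrtr_sqr normr_id.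
by rewrite ler_sqrt // mulr_ge0.
Qed.

(** * Entropy against the binomial coefficient, and assembly *)

Lemma entropy_lt_sqrt_binomial (R : rcfType) (n l : nat) : (0 < n)%N -> (l <= n)%N ->
  n%:R ^+ n / (l%:R ^+ l * (n - l)%:R ^+ (n - l))
    < 3 * Num.sqrt (l + 1)%:R * 'C(n, l)%:R :> R.
Proof.
move=> n0 ln.
have q1 : 1 <= Num.sqrt (l + 1)%:R :> R.
  by rewrite -[X in X <= _]sqrtr1 ler_sqrt ?ler1n ?addn1.
have nn0 : n%:R ^+ n != 0 :> R by rewrite expf_neq0 // pnatr_eq0 -lt0n.
have [l0|l0] := posnP l.
  by rewrite l0 subn0 expr0 mul1r divff // bin0; rewrite l0 in q1; lra.
have [ln'|nl] := ltnP l n; last first.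
  have -> : l = n by apply/eqP; rewrite eqn_leq ln.
  have q1' : 1 <= Num.sqrt (n + 1)%:R :> R.
    by rewrite -[X in X <= _]sqrtr1 ler_sqrt ?ler1n ?addn1.
  by rewrite subnn expr0 mulr1 divff // binn; lra.
have m0 : (0 < n - l)%N by rewrite subn_gt0.
have := @entropy_binomial_bound R l (n - l) l0 m0; rewrite subnKC //.
set B := _ / _; set C := 'C(n, l)%:R => HB.
have C0 : 0 < C by rewrite ltr0n bin_gt0.
have B0 : 0 <= B by rewrite divr_ge0 ?mulr_ge0 ?exprn_ge0.
have n0R : 0 < n%:R :> R by rewrite ltr0n.
have T0 : 0 <= 3 * Num.sqrt (l + 1)%:R * C by rewrite !mulr_ge0 ?sqrtr_ge0 // ltW.
rewrite -(ltr_pXn2r (_ : 0 < 2)%N) ?nnegrE //.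
have -> : (3 * Num.sqrt (l + 1)%:R * C) ^+ 2 = 9 * (l%:R + 1) * C ^+ 2.
  by rewrite !exprMn sqr_sqrtr // natrD -natrX.
have mn : (n - l)%:R <= n%:R :> R by rewrite ler_nat leq_subr.
have lC : 0 <= 8 * l%:R * C ^+ 2 by rewrite !mulr_ge0 ?sqr_ge0.
(* The factor [(n - l) / n <= 1] is dropped; then [8 l < 9 (l + 1)] gives the strict inequality. *)
have {}HB : B ^+ 2 <= 8 * l%:R * C ^+ 2.
  rewrite -(ler_pM2r n0R) (le_trans HB) //.
  by have := ler_wpM2l lC mn; lra.
have C2 : 0 < C ^+ 2 by rewrite exprn_gt0.
have lC2 : 0 <= l%:R * C ^+ 2 by rewrite mulr_ge0 // ltW.
lra.
Qed.

(* The inequalities are stated in R[i], where a <= b (resp. a < b) means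
   Im a = Im b and Re a <= Re b (resp. Re a < Re b); the norm `|z| of z : R[i]
   is the usual modulus, embedded in R[i]. In the library 0 ^+ 0 = 1. *)
Theorem theorem4p3 (R : realType) (n l : nat) (n_ge1 : (1 <= n)%N)
    (l_le_n : (l <= n)%N) (x : 'I_n -> R[i])
    (sum_x : \sum_(i < n) x i = 0)
    (sum_norm_x : \sum_(i < n) `|x i| ^+ 2 = n%:R) :
  (`|elemsym l x| ^+ 2
     <= n%:R ^+ n / (l%:R ^+ l * (n - l)%:R ^+ (n - l))
     < 3 * (Num.sqrt (l + 1)%:R : R)%:C * 'C(n, l)%:R)
  /\ ((forall i, x i \is Num.real) ->
      `|elemsym l x| <= (Num.sqrt (10 * 'C(n, l)%:R) : R)%:C).
Proof.
have e2 := elemsym_sqr_le n_ge1 l_le_n sum_x sum_norm_x.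
split.
  rewrite e2 /=.
  have := entropy_lt_sqrt_binomial R n_ge1 l_le_n; rewrite -ltcR.
  by rewrite fmorph_div !rmorphM !rmorphXn !rmorph_nat.
(* At [l = 0] and [l = n] the quotient is 1, and the bound of part 1 already gives [|e_l| <= 1]. *)
move=> xR; have e1 : n%:R ^+ n / (l%:R ^+ l * (n - l)%:R ^+ (n - l)) = 1 :> R[i] ->
    `|elemsym l x| <= (Num.sqrt (10 * 'C(n, l)%:R) : R)%:C.
  move=> E; rewrite E -[leRHS]expr1 expr_le1 // in e2.
  apply: le_trans e2 _; rewrite -[1](rmorph1 (real_complex R)) lecR.
  rewrite -[leLHS]sqrtr1 ler_sqrt ?mulr_ge0 //.
  have : 1 <= 'C(n, l)%:R :> R by rewrite ler1n bin_gt0.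
  by lra.
have nn0 : n%:R ^+ n != 0 :> R[i] by rewrite expf_neq0 // pnatr_eq0 -lt0n.
have [l0|l0] := posnP l.
  by apply: e1; rewrite l0 subn0 expr0 mul1r divff.
have [ln|nl] := ltnP l n; last first.
  have En : l = n by apply/eqP; rewrite eqn_leq l_le_n.
  by apply: e1; rewrite En subnn expr0 mulr1 divff.
pose y i := complex.Re (x i).
have xE i : x i = (y i)%:C by rewrite /y RRe_real.
have -> : elemsym l x = (elemsym l y)%:C.
  rewrite -elemsym_realC; apply: eq_bigr => S _; apply: eq_bigr => i _; exact: xE.
rewrite normc_realC lecR elemsym_real_le //.
  by apply: complexI; rewrite rmorph_sum -[RHS]sum_x; apply: eq_bigr => i _; rewrite xE.
apply: complexI; rewrite rmorph_sum rmorph_nat -[RHS]sum_norm_x; apply: eq_bigr => i _.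
by rewrite xE normc_realC -rmorphXn /= real_normK ?num_real.
Qed.
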